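(* Let $r\ge3$ and $r/2<s\le r-1$, and let $H$ be an $s$-connected $r$-uniform hypergraph on a finite vertex set $V$, $|V|=n\ge r$. Let $\lambda_1^{(s)}$ be the smallest nonzero eigenvalue of the Laplacian of $D^{(s)}$. Then the $s$-diameter of $H$ satisfies $$\mathrm{diam}^{(s)}(H)\le\left\lceil\frac{2\log\frac{\mathrm{vol}(V^{\underline{s}})}{\delta^{(s)}}}{\log\frac{2}{2-\lambda_1^{(s)}}}\right\rceil,$$ where $\mathrm{vol}(V^{\underline{s}})=\sum_{x\in V^{\underline{s}}}d_x=|E(H)|\,r!$ and $\delta^{(s)}=\min_x d_x$ is the minimum degree in $D^{(s)}$.
   Context: $V^{\underline{s}}$ is the set of ordered $s$-tuples of distinct elements of $V$; for $x\in V^{\underline{s}}$, $[x]$ is the $s$-set of its coordinates. An $r$-uniform hypergraph $H$ has edge set $E(H)\subseteq\binom{V}{r}$. For $S\subseteq V$ with $|S|<r$, $d_S$ is the number of edges containing $S$. An $s$-walk of length $k\ge 0$ is a sequence of vertices $v_1,\dots,v_{(r-s)(k-1)+r}$ such that $F_i=\{v_{(r-s)(i-1)+1},\dots,v_{(r-s)(i-1)+r}\}$ is an edge of $H$ (with $r$ distinct vertices) for $1\le i\le k$. Its $i$-th stop ($0\le i\le k$) is $x_i=(v_{(r-s)i+1},\dots,v_{(r-s)i+s})\in V^{\underline{s}}$; it starts at $x_0$ and ends at $x_k$. It is an $s$-path if all its stops are distinct. The $s$-distance $d^{(s)}(x,y)$ is the minimum length of an $s$-path from $x$ to $y$. $H$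 is $s$-connected if $d^{(s)}(x,y)$ is finite for all $x,y\in V^{\underline{s}}$, and then $\mathrm{diam}^{(s)}(H)=\max_{x,y\in V^{\underline{s}}}d^{(s)}(x,y)$. For $r/2<s\le r-1$, $D^{(s)}$ is the directed graph on $V^{\underline{s}}$ in which $(x,y)$ is an edge iff $x_{r-s+j}=y_j$ for $1\le j\le 2s-r$ and $[x]\cup[y]\in E(H)$. Each $x$ has out-degree and in-degree both equal to $d_x=d_{[x]}(r-s)!$, so $D^{(s)}$ is Eulerian; the $s$-distance in $H$ equals the directed distance in $D^{(s)}$. Let $A$ be the adjacency matrix of $D^{(s)}$, $T=\mathrm{diag}(d_x)$, $\vec{\mathcal L}=I-T^{-1/2}AT^{-1/2}$; the Laplacian of $D^{(s)}$ is $\mathcal L^{(s)}=(\vec{\mathcal L}+\vec{\mathcal L}^{\top})/2$, whose eigenvalues are real and nonnegative. *)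

(* Defs.v *)
From mathcomp Require Import all_boot all_order all_algebra.

Set Implicit Arguments.
Unset Strict Implicit.
Unset Printing Implicit Defensive.

Import Order.TTheory GRing.Theory Num.Theory.

Record hypergraph (V : finType) (r : nat) := Hypergraph {
  edges : {set {set V}};
  edges_uniform : forall e : {set V}, e \in edges -> #|e| = r
}.

(* Ordered s-tuples of distinct elements of V. *)
Definition dtuple (V : finType) (s : nat) : finType :=
  {x : s.-tuple V | uniq x}.

Definition coords (V : finType) (s : nat) (x : dtuple V s) : seq V :=
  tval (sval x).

Definition support (V : finType) (s : nat) (x : dtuple V s) : {set V} :=
  [set:: coords x].

Section Walks.
Variables (V : finType) (r : nat) (H : hypergraph V r) (s : nat).

(* Sequences are indexed from 0: the (i+1)-st edge of a walk and its i-th stop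
   both begin at position (r - s) * i. *)
Definition walk_edge (v : seq V) (i : nat) : {set V} :=
  [set:: take r (drop ((r - s) * i) v)].

Definition stop (v : seq V) (i : nat) : seq V :=
  take s (drop ((r - s) * i) v).

(* The length (r - s)(k - 1) + r of the vertex sequence of a walk of length k
   is written (r - s) * k + s, which avoids truncated subtraction at k = 0.
   Since every edge has r elements, walk_edge v i \in edges H forces the r
   entries of that window, hence also those of the stops inside it, to be
   distinct. For k = 0 the sequence is a single stop, and it is distinct
   because walks are only considered from some x : dtuple V s. *)
Definition is_walk (k : nat) (v : ((r - s) * k + s).-tuple V) : bool :=
  [forall i : 'I_k, walk_edge v i \in edges H].

Definition is_path (k : nat) (v : ((r - s) * k + s).-tuple V) : bool :=
  is_walk v && uniq [seq stop v i | i <- iota 0 k.+1].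

Definition has_path (x y : dtuple V s) (k : nat) : bool :=
  [exists v : ((r - s) * k + s).-tuple V,
     [&& is_path v, stop v 0 == coords x & stop v k == coords y]].

Definition s_connected : Prop :=
  forall x y : dtuple V s, exists k : nat, has_path x y k.

Definition s_distance (conn : s_connected) (x y : dtuple V s) : nat :=
  ex_minn (conn x y).

Definition s_diameter (conn : s_connected) : nat :=
  \max_(x : dtuple V s) \max_(y : dtuple V s) s_distance conn x y.

End Walks.

Section Laplacian.
Variables (V : finType) (r : nat) (H : hypergraph V r) (s : nat).

Definition set_degree (S : {set V}) : nat :=
  #|[set e in edges H | S \subset e]|.

Definition degree (x : dtuple V s) : nat :=
  set_degree (support x) * (r - s)`!.

Definition volume : nat := \sum_(x : dtuple V s) degree x.

(* The default value volume of the iterated minimum bounds every degree, so it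
   is irrelevant as soon as dtuple V s is inhabited. *)
Definition min_degree : nat :=
  \big[minn/volume]_(x : dtuple V s) degree x.

(* Both sides of the first condition are sequences of length 2s - r. *)
Definition darc (x y : dtuple V s) : bool :=
  (drop (r - s) (coords x) == take (2 * s - r) (coords y))
  && (support x :|: support y \in edges H).

Local Open Scope ring_scope.
Variable R : rcfType.

(* Matrices over the vertices of the digraph are indexed by 'I_#|dtuple V s|
   through enum_val. *)
Definition adjacency : 'M[R]_#|dtuple V s| :=
  \matrix_(i, j) (darc (enum_val i) (enum_val j))%:R.

(* T^(-1/2); the inverses are genuine whenever all degrees are positive. *)
Definition degree_invsqrt : 'M[R]_#|dtuple V s| :=
  diag_mx (\row_i (Num.sqrt (degree (enum_val i))%:R)^-1).

Definition dlaplacian : 'M[R]_#|dtuple V s| :=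
  1%:M - degree_invsqrt *m adjacency *m degree_invsqrt.

Definition laplacian : 'M[R]_#|dtuple V s| :=
  2^-1 *: (dlaplacian + dlaplacian^T).

End Laplacian.

Definition smallest_nonzero_eigenvalue (R : rcfType) (n : nat)
    (M : 'M[R]_n) (lambda : R) : Prop :=
  [/\ eigenvalue M lambda, lambda != 0%R
    & forall mu : R, eigenvalue M mu -> mu != 0%R -> (lambda <= mu)%R].

(* Main.v *)
Require Import Defs.
From mathcomp Require Import all_boot all_order all_algebra.
From mathcomp Require Import reals exp.
From mathcomp Require Import complex ring lra zify.

(** Let M = T^(-1/2) A T^(-1/2) and phi = (sqrt d_x)_x. The digraph is Eulerian,
   so phi is fixed by M and by its transpose; hence M is a contraction, and by
   s-connectedness the kernel of the Laplacian 1 - (M + M^T) / 2 is spanned by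
   phi. On the orthogonal complement of phi the Laplacian is therefore bounded
   below by lambda_1, and the lazy walk P = (1 + M) / 2 satisfies
     |f P|^2 = (|f|^2 + 2 <f M, f> + |f M|^2) / 4 <= (1 - lambda_1 / 2) |f|^2.
   Splitting the unit vectors at x and y along phi and its complement, the (x, y)
   entry of P^t is at least sqrt (d_x d_y) / vol minus an error term that is
   smaller than (1 - lambda_1 / 2)^(t / 2). When the latter is at most delta / vol
   the entry is nonzero, so y can be reached from x in at most t steps.

   The logarithm in the denominator is positive because 0 < lambda_1 <= 1. *)

Set Implicit Arguments.
Unset Strict Implicit.
Unset Printing Implicit Defensive.

Import Order.TTheory GRing.Theory Num.Theory.
Local Open Scope ring_scope.

(* GRing exports a notation of the same name. *)
Local Notation support := Defs.support.

(** * Spectral gap of a symmetric matrix *)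

Definition dot (R : rcfType) n (u v : 'rV[R]_n) : R := (u *m v^T) 0 0.

Section Dot.
Variables (R : rcfType) (n : nat).
Implicit Types (u v w : 'rV[R]_n) (M : 'M[R]_n) (a : R).

Lemma dotE u v : dot u v = \sum_i u 0 i * v 0 i.
Proof. by rewrite /dot mxE; apply: eq_bigr => i _; rewrite mxE. Qed.

Lemma dotC u v : dot u v = dot v u.
Proof. by rewrite !dotE; apply: eq_bigr => i _; rewrite mulrC. Qed.

Lemma dotDl u v w : dot (u + v) w = dot u w + dot v w.
Proof. by rewrite /dot mulmxDl mxE. Qed.

Lemma dotDr u v w : dot u (v + w) = dot u v + dot u w.
Proof. by rewrite dotC dotDl !(dotC u). Qed.

Lemma dotZl a u v : dot (a *: u) v = a * dot u v.
Proof. by rewrite /dot -scalemxAl mxE. Qed.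

Lemma dotZr a u v : dot u (a *: v) = a * dot u v.
Proof. by rewrite dotC dotZl dotC. Qed.

Lemma dotNl u v : dot (- u) v = - dot u v.
Proof. by rewrite -scaleN1r dotZl mulN1r. Qed.

Lemma dotNr u v : dot u (- v) = - dot u v.
Proof. by rewrite dotC dotNl dotC. Qed.

Definition dot_linear := (dotDl, dotDr, dotNl, dotNr, dotZl, dotZr).

Lemma dot_mulmx u M v : dot (u *m M) v = dot u (v *m M^T).
Proof. by rewrite /dot trmx_mul trmxK mulmxA. Qed.

Lemma dot_delta u i : dot u (delta_mx 0 i) = u 0 i.
Proof.
rewrite dotE (bigD1 i) //= mxE !eqxx mulr1 big1 ?addr0 // => j ne_ji.
by rewrite mxE (negPf ne_ji) mulr0.
Qed.

Lemma dot_ge0 u : 0 <= dot u u.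
Proof. by rewrite dotE sumr_ge0 // => i _; rewrite -expr2 sqr_ge0. Qed.

Lemma dot_eq0 u : (dot u u == 0) = (u == 0).
Proof.
apply/eqP/eqP => [|->]; last by rewrite /dot mul0mx mxE.
rewrite dotE => /psumr_eq0P u0; apply/rowP => i; rewrite mxE.
by apply/eqP; rewrite -sqrf_eq0 expr2 u0 // => j _; rewrite -expr2 sqr_ge0.
Qed.

Lemma dot_gt0 u : (0 < dot u u) = (u != 0).
Proof. by rewrite lt_def dot_eq0 dot_ge0 andbT. Qed.

Lemma dot_cauchy_schwarz u v : dot u v ^+ 2 <= dot u u * dot v v.
Proof.
have [->|v0] := eqVneq v 0.
  have dot0 (x : 'rV_n) : dot x 0 = 0 :> R by rewrite dotE big1 // => i _; rewrite mxE mulr0.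
  by rewrite !dot0 mulr0 expr0n.
rewrite -subr_ge0 -(pmulr_lge0 _ (x := dot v v)) ?dot_gt0 //.
(* The squared norm of this vector is [dot v v] times the difference of the two sides. *)
have := dot_ge0 (dot v v *: u - dot u v *: v).
rewrite !dot_linear (dotC v u); set x := dot u v; set y := dot v v.
by congr (0 <= _); ring.
Qed.

End Dot.

(* Diagonalise the matrix over R[i]: an orthonormal eigenvector with eigenvalue
   0 is a multiple of phi and does not see f, and each of the other eigenvalues
   is an eigenvalue over R. *)
Lemma rayleigh_lower_bound (R : rcfType) n (L : 'M[R]_n) (phi : 'rV[R]_n)
    (lam : R) :
    L^T = L -> (kermx L <= phi)%MS ->
    (forall mu, eigenvalue L mu -> mu != 0 -> lam <= mu) ->
  forall f, dot f phi = 0 -> lam * dot f f <= dot (f *m L) f.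
Proof.
move=> symL kerL lamP f f_phi.
pose toC : {rmorphism R -> R[i]} := real_complex R.
pose A := map_mx toC L; pose fC := map_mx toC f.
have realC m (B : 'M[R]_(m, n)) : map_mx toC B \is a realmx.
  by apply/mxOverP => i j; rewrite mxE; apply/complex_realP; exists (B i j).
have trA : A^T = A by rewrite /A map_trmx symL.
have hermA : A \is hermsymmx.
  apply: realsym_hermsym; last exact: realC.
  by apply/is_hermitianmxP; rewrite trA expr0 scale1r map_mx_id.
have /orthomx_spectralP := hermitian_normalmx hermA.
set P := spectralmx A; set D := spectral_diag A => defA.
have unitP : P \is unitarymx := spectral_unitarymx A.
have invP : invmx P = map_mx Num.conj P^T by rewrite invmx_unitary.
have PA : P *m A = diag_mx D *m P.
  by rewrite {1}defA !mulmxA mulmxV ?mul1mx // spectral_unit.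
(* The coordinates of [f] in the eigenbasis formed by the rows of [P]. As [f] is real, their
   conjugates are the entries of P f^T. *)
pose w := fC *m invmx P.
have wC : map_mx Num.conj w^T = P *m fC^T.
  rewrite /w invP trmx_mul map_mxM /=; congr (_ *m _).
    by rewrite map_trmx trmxK -map_mx_comp (map_mx_id (@conjCK _)).
  by rewrite -map_trmx realmxC ?realC.
have normf : toC (dot f f) = \sum_i `|w 0 i| ^+ 2.
  have -> : toC (dot f f) = (w *m map_mx Num.conj w^T) 0 0.
    by rewrite wC /w mulmxA mulmxKV ?spectral_unit // /dot /fC map_trmx -map_mxM [RHS]mxE.
  by rewrite mxE; apply: eq_bigr => i _; rewrite normCK; congr (_ * _); rewrite 2!mxE.
have formf : toC (dot (f *m L) f) = \sum_i D 0 i * `|w 0 i| ^+ 2.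
  have -> : toC (dot (f *m L) f) = (w *m diag_mx D *m map_mx Num.conj w^T) 0 0.
    have -> : w *m diag_mx D *m map_mx Num.conj w^T = fC *m A *m fC^T.
      by rewrite wC defA /w !mulmxA.
    by rewrite /dot /fC /A map_trmx -!map_mxM [RHS]mxE.
  rewrite mxE; apply: eq_bigr => i _.
  by rewrite mul_mx_diag mxE mulrAC mulrC normCK; congr (_ * (_ * _)); rewrite 2!mxE.
(* Over R[i] the difference is the sum of (D_i - lam) |w_i|^2, and each term is shown to be
   nonnegative. *)
suff: 0 <= toC (dot (f *m L) f - lam * dot f f) by rewrite ler0c subr_ge0.
rewrite rmorphB rmorphM normf formf mulr_sumr -sumrB.
apply: sumr_ge0 => i _; rewrite -mulrBl.
have rowPA : row i P *m A = D 0 i *: row i P.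
  by rewrite -row_mul PA row_mul row_diag_mx -scalemxAl -rowE.
have rowP0 : row i P != 0.
  apply/eqP; rewrite rowE => /(congr1 (mulmx^~ (invmx P))) /matrixP/(_ 0 i).
  by rewrite mulmxK ?spectral_unit // mul0mx !mxE !eqxx => /eqP; rewrite oner_eq0.
have /mxOverP/(_ 0 i)/complex_realP[mu Dmu] := hermitian_spectral_diag_real hermA.
have {}Dmu : D 0 i = toC mu := Dmu.
have eigmu : eigenvalue L mu.
  by rewrite -(eigenvalue_map toC);
    apply/eigenvalueP; exists (row i P) => //; rewrite -/A rowPA Dmu.
have [mu0|mu_neq0] := eqVneq mu 0; last first.
  apply: mulr_ge0; last exact: exprn_ge0.
  by rewrite Dmu -rmorphB ler0c subr_ge0 lamP.
suff -> : w 0 i = 0 by rewrite normr0 expr0n mulr0.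
have: (row i P <= map_mx toC phi)%MS.
  apply: submx_trans (_ : (map_mx toC (kermx L) <= _)%MS); last by rewrite map_submx.
  by rewrite map_kermx; apply/sub_kermxP; rewrite rowPA Dmu mu0 rmorph0 scale0r.
case/sub_rVP => c rowPi.
have: (map_mx Num.conj w^T) i 0 = 0.
  have -> : (map_mx Num.conj w^T) i 0 = (row i P *m fC^T) 0 0.
    by rewrite wC -row_mul [RHS]mxE.
  rewrite rowPi -scalemxAl /fC map_trmx -map_mxM mxE.
  rewrite (_ : map_mx _ _ 0 0 = toC (dot phi f)); last by rewrite mxE.
  by rewrite dotC f_phi rmorph0 mulr0.
by rewrite 2!mxE => /eqP; rewrite conjC_eq0 => /eqP.
Qed.

(** * Lazy walks *)

Section Doubly.
Variables (R : rcfType) (n : nat) (phi : 'rV[R]_n).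
Hypothesis phi_gt0 : forall i, 0 < phi 0 i.
Implicit Types (M : 'M[R]_n) (f : 'rV[R]_n).

Let phi_neq0 i : phi 0 i != 0. Proof. by rewrite gt_eqF. Qed.

(** This is the Dirichlet form of [M]. When the square is expanded, each pure square sums to |f|^2,
    because [phi] is fixed by [M] and by its transpose, and the mixed term sums to -2 <f M, f>. *)
Lemma energyE M f : phi *m M = phi -> phi *m M^T = phi ->
  dot f f - dot (f *m M) f = 2^-1 * \sum_i \sum_j
    M i j * (phi 0 i * phi 0 j) * (f 0 i / phi 0 i - f 0 j / phi 0 j) ^+ 2.
Proof.
move=> phiM phiMT.
have colM j : \sum_i phi 0 i * M i j = phi 0 j by rewrite -[in RHS]phiM mxE.
have rowM i : \sum_j phi 0 j * M i j = phi 0 i.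
  rewrite -[in RHS]phiMT mxE.
  by apply: eq_bigr => j _; rewrite mxE.
have term i j : M i j * (phi 0 i * phi 0 j) * (f 0 i / phi 0 i - f 0 j / phi 0 j) ^+ 2 =
    f 0 i ^+ 2 / phi 0 i * (phi 0 j * M i j) +
    f 0 j ^+ 2 / phi 0 j * (phi 0 i * M i j) - 2 * (f 0 i * M i j * f 0 j).
  by field; rewrite !phi_neq0.
under eq_bigr do under eq_bigr do rewrite term.
have -> : dot (f *m M) f = \sum_i \sum_j f 0 i * M i j * f 0 j.
  rewrite exchange_big dotE; apply: eq_bigr => j _ /=.
  by rewrite mxE mulr_suml.
have normf : dot f f = \sum_i f 0 i ^+ 2 / phi 0 i * phi 0 i.
  by rewrite dotE; apply: eq_bigr => i _; rewrite divfK.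
have -> : \sum_i \sum_j (f 0 i ^+ 2 / phi 0 i * (phi 0 j * M i j) +
    f 0 j ^+ 2 / phi 0 j * (phi 0 i * M i j) - 2 * (f 0 i * M i j * f 0 j)) =
    dot f f + dot f f - 2 * \sum_i \sum_j f 0 i * M i j * f 0 j.
  under eq_bigr do rewrite !big_split /= sumrN -!mulr_sumr rowM.
  rewrite !big_split /= sumrN -mulr_sumr -normf; congr (_ + _ - _).
  rewrite exchange_big normf; apply: eq_bigr => j _ /=.
  by rewrite -mulr_sumr colM.
by field.
Qed.

Lemma dot_mulmx_le M f : (forall i j, 0 <= M i j) ->
  phi *m M = phi -> phi *m M^T = phi -> dot (f *m M) f <= dot f f.
Proof.
move=> M0 phiM phiMT; rewrite -subr_ge0 energyE // mulr_ge0 ?invr_ge0 //.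
apply: sumr_ge0 => i _; apply: sumr_ge0 => j _.
by rewrite mulr_ge0 ?sqr_ge0 // mulr_ge0 // ltW // mulr_gt0.
Qed.

(* M *m M^T satisfies the hypotheses of dot_mulmx_le when M does. *)
Lemma dot_mulmx_contract M f : (forall i j, 0 <= M i j) ->
  phi *m M = phi -> phi *m M^T = phi -> dot (f *m M) (f *m M) <= dot f f.
Proof.
move=> M0 phiM phiMT; rewrite dot_mulmx -mulmxA dotC; apply: dot_mulmx_le.
- by move=> i j; rewrite mxE sumr_ge0 // => k _; rewrite mxE mulr_ge0.
- by rewrite mulmxA phiM.
- by rewrite trmx_mul trmxK mulmxA phiM.
Qed.

(** Equality makes the energy vanish, hence each of its nonnegative terms. So f_i / phi_i takes the
    same value at both ends of every nonzero entry of [M], and connectedness makes it constant. *)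
Lemma fixed_multiple M f : (forall i j, 0 <= M i j) ->
    phi *m M = phi -> phi *m M^T = phi ->
    (forall i j, connect (fun i j => M i j != 0) i j) ->
  dot (f *m M) f = dot f f -> (f <= phi)%MS.
Proof.
move=> M0 phiM phiMT conM fixf.
have term0 i j : M i j != 0 -> f 0 i / phi 0 i = f 0 j / phi 0 j.
  move=> Mij; apply/eqP; rewrite -subr_eq0 -sqrf_eq0.
  have := energyE f phiM phiMT; rewrite fixf subrr => /esym/eqP.
  have pos i' j' : 0 <= M i' j' * (phi 0 i' * phi 0 j') *
      (f 0 i' / phi 0 i' - f 0 j' / phi 0 j') ^+ 2.
    by rewrite mulr_ge0 ?sqr_ge0 // mulr_ge0 // ltW // mulr_gt0.
  rewrite mulf_eq0 invr_eq0 pnatr_eq0 /= psumr_eq0; last first.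
    by move=> i' _; apply: sumr_ge0.
  move=> /allP/(_ i (mem_index_enum _)) /=; rewrite psumr_eq0 //.
  move=> /allP/(_ j (mem_index_enum _)) /=.
  by rewrite !mulf_eq0 (negPf Mij) !(negPf (phi_neq0 _)).
have ratio i j : f 0 i / phi 0 i = f 0 j / phi 0 j.
  have /connectP[p] := conM i j.
  elim: p i => [|k p IHp] i /=; first by move=> _ ->.
  by case/andP=> /term0-> pth lastp; apply: IHp.
(* In dimension 0 there is no index at which to read off the constant ratio. *)
have [k _|no_idx] := pickP (fun _ : 'I_n => true); apply/sub_rVP; last first.
  by exists 0; apply/rowP => i; have := no_idx i.
by exists (f 0 k / phi 0 k); apply/rowP => j; rewrite mxE (ratio k j) divfK.
Qed.

(** Averaging with the identity brings the gap into play: [M] alone may preserve the norm on the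
    complement of [phi], as a cyclic permutation matrix does. *)
Definition lazy M : 'M[R]_n := 2^-1 *: (1%:M + M).

Lemma mulmx_lazy M f : f *m lazy M = 2^-1 *: (f + f *m M).
Proof. by rewrite /lazy -scalemxAr mulmxDr mulmx1. Qed.

Section Gap.
Variables (M : 'M[R]_n) (lam : R).
Hypothesis M0 : forall i j, 0 <= M i j.
Hypothesis phiM : phi *m M = phi.
Hypothesis phiMT : phi *m M^T = phi.
Hypothesis lam_lt2 : lam < 2.
Hypothesis gapM : forall f, dot f phi = 0 -> lam * dot f f <= dot f f - dot (f *m M) f.

Let rate_gt0 : 0 < 1 - lam / 2.
Proof. by rewrite subr_gt0 ltr_pdivrMr // mul1r. Qed.

(** The gap bounds the mixed term <f M, f> by (1 - lam) |f|^2 and the contraction property bounds |f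
    M|^2 by |f|^2; (1 + 2 (1 - lam) + 1) / 4 is 1 - lam / 2. *)
Lemma lazy_contract f : dot f phi = 0 ->
  dot (f *m lazy M) (f *m lazy M) <= (1 - lam / 2) * dot f f.
Proof.
move=> f_phi; rewrite mulmx_lazy !dot_linear (dotC f (f *m M)).
have := gapM f_phi; have := dot_mulmx_contract f M0 phiM phiMT.
set a := dot f f; set b := dot (f *m M) f; set c := dot (f *m M) (f *m M).
lra.
Qed.

Lemma phi_lazy : phi *m lazy M = phi.
Proof. by rewrite mulmx_lazy phiM -mulr2n -scaler_nat scalerA mulVf ?scale1r ?pnatr_eq0. Qed.

Lemma lazy_orthogonal f : dot f phi = 0 -> dot (f *m lazy M) phi = 0.
Proof.
by move=> f0; rewrite mulmx_lazy !dot_linear dot_mulmx phiMT f0 addr0 mulr0.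
Qed.

Lemma lazy_iter_contract f t : dot f phi = 0 ->
  dot (f *m lazy M ^+ t) (f *m lazy M ^+ t) <= (1 - lam / 2) ^+ t * dot f f.
Proof.
elim: t f => [|t IHt] f f0; first by rewrite !expr0 mulmx1 mul1r.
rewrite exprS -[_ * _]/(_ *m _) mulmxA.
apply: le_trans (IHt _ (lazy_orthogonal f0)) _.
rewrite exprSr -mulrA ler_wpM2l ?lazy_contract // exprn_ge0 // ltW //.
Qed.

Lemma phi_lazy_iter t : phi *m lazy M ^+ t = phi.
Proof.
elim: t => [|t IHt]; first by rewrite expr0 mulmx1.
by rewrite exprS -[_ * _]/(_ *m _) mulmxA phi_lazy.
Qed.

Lemma lazy_iter_orthogonal f t : dot f phi = 0 -> dot (f *m lazy M ^+ t) phi = 0.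
Proof.
elim: t f => [|t IHt] f f0; first by rewrite expr0 mulmx1.
by rewrite exprS -[_ * _]/(_ *m _) mulmxA IHt ?lazy_orthogonal.
Qed.

(** If the entry were 0, the contribution of the complements of [phi] would cancel phi_x phi_y /
    |phi|^2 exactly. By Cauchy-Schwarz and the contraction, the square of that contribution is too
    small. *)
Lemma lazy_iter_neq0 t x y :
    (1 - lam / 2) ^+ t <= (phi 0 x * phi 0 y / dot phi phi) ^+ 2 ->
  (lazy M ^+ t) x y != 0.
Proof.
move=> small; apply/eqP => entry0.
set N := dot phi phi in small; pose e z : 'rV[R]_n := delta_mx 0 z.
have N_gt0 : 0 < N.
  by rewrite dot_gt0; apply/eqP => /rowP/(_ x); rewrite mxE => /eqP; rewrite (negPf (phi_neq0 x)).
have N0 : N != 0 by rewrite gt_eqF.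
pose f z := e z - (phi 0 z / N) *: phi.
have ee z : dot (e z) (e z) = 1 by rewrite dot_delta mxE !eqxx.
have pe z : dot phi (e z) = phi 0 z by rewrite dot_delta.
have fphi z : dot (f z) phi = 0.
  by rewrite /f !dot_linear (dotC _ phi) pe divfK ?subrr.
have ff z : dot (f z) (f z) = 1 - phi 0 z ^+ 2 / N.
  by rewrite /f !dot_linear ee (dotC (e z)) pe -/N; field.
(* Strictness here, from the positivity of [phi], is what allows a non-strict inequality in the
   hypothesis. *)
have ff1 z : dot (f z) (f z) < 1.
  by rewrite ff gtrDl oppr_lt0 divr_gt0 ?exprn_gt0.
have decomp z : e z = (phi 0 z / N) *: phi + f z by rewrite /f addrC subrK.
have fPf : dot (f x *m lazy M ^+ t) (f y) = - (phi 0 x * phi 0 y / N).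
  have : dot (e x *m lazy M ^+ t) (e y) = 0.
    by rewrite dot_delta /e -rowE mxE.
  rewrite (decomp x) mulmxDl -scalemxAl phi_lazy_iter dotDl dotZl pe (decomp y).
  rewrite dotDr dotZr lazy_iter_orthogonal // mulr0 add0r.
  by move/eqP; rewrite addrC addr_eq0 => /eqP->; rewrite mulrAC.
have := dot_cauchy_schwarz (f x *m lazy M ^+ t) (f y); rewrite fPf sqrrN leNgt => /negP; apply.
apply: lt_le_trans small.
have rho_gt0 : 0 < (1 - lam / 2) ^+ t by rewrite exprn_gt0.
apply: le_lt_trans (_ : (1 - lam / 2) ^+ t * (dot (f x) (f x) * dot (f y) (f y)) < _).
  by rewrite mulrA ler_wpM2r ?dot_ge0 // lazy_iter_contract.
by rewrite -[ltRHS]mulr1 ltr_pM2l // mulr_ilt1 ?dot_ge0.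
Qed.

End Gap.
End Doubly.

Lemma lazy_iter_path (R : rcfType) n (M : 'M[R]_n) t x y :
    (lazy M ^+ t) x y != 0 ->
  exists p, [/\ path (fun i j => M i j != 0) x p, last x p = y & (size p <= t)%N].
Proof.
elim: t x => [|t IHt] x.
  rewrite expr0 mxE; case: (eqVneq x y) => [-> _|_]; last by rewrite eqxx.
  by exists [::].
rewrite exprS -[_ * _]/(_ *m _) mxE.
have [z Pz|all0] := pickP (fun z => lazy M x z * (lazy M ^+ t) z y != 0); last first.
  by rewrite big1 ?eqxx // => z _; apply/eqP/negbFE/all0.
move=> _; move: Pz; rewrite mulf_eq0 negb_or => /andP[xz /IHt[p [pth lastp szp]]].
move: xz; rewrite !mxE mulf_eq0 invr_eq0 pnatr_eq0 /=.
(* A step that stays at [x] adds nothing to the path, so only an upper bound on the size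
   survives. *)
case: (eqVneq x z) => [->|_] xz; first by exists p; rewrite leqW.
by exists (z :: p); split=> //=; rewrite pth andbT; move: xz; rewrite add0r.
Qed.

(** * The Laplacian of a nonnegative matrix with a positive fixed vector *)

Definition symmetrized_laplacian (R : rcfType) n (M : 'M[R]_n) : 'M[R]_n :=
  1%:M - 2^-1 *: (M + M^T).

Section SymmetrizedLaplacian.
Variables (R : rcfType) (n : nat) (phi : 'rV[R]_n) (M : 'M[R]_n) (lam : R).
Hypothesis phi_gt0 : forall i, 0 < phi 0 i.
Hypothesis M0 : forall i j, 0 <= M i j.
Hypothesis phiM : phi *m M = phi.
Hypothesis phiMT : phi *m M^T = phi.
Hypothesis conM : forall i j, connect (fun i j => M i j != 0) i j.
Hypothesis lamP : smallest_nonzero_eigenvalue (symmetrized_laplacian M) lam.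
Implicit Types f : 'rV[R]_n.

Local Notation L := (symmetrized_laplacian M).

(** A matrix and its transpose have the same quadratic form, so symmetrizing does not change it. *)
Lemma laplacian_form f : dot (f *m L) f = dot f f - dot (f *m M) f.
Proof.
rewrite mulmxBr mulmx1 -scalemxAr mulmxDr !dot_linear.
by rewrite (dot_mulmx f M^T) trmxK (dotC f (f *m M)); field.
Qed.

Lemma eigenvalue_laplacian_ge0 mu : eigenvalue L mu -> 0 <= mu.
Proof.
case/eigenvalueP=> f fL f0; rewrite -(pmulr_lge0 _ (x := dot f f)) ?dot_gt0 //.
by rewrite -dotZl -fL laplacian_form subr_ge0 (dot_mulmx_le phi_gt0).
Qed.

(** A kernel vector of the Laplacian satisfies <f M, f> = |f|^2, so it is a multiple of [phi]; this
    is the kernel condition of [rayleigh_lower_bound]. *)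
Lemma spectral_gap f : dot f phi = 0 ->
  lam * dot f f <= dot f f - dot (f *m M) f.
Proof.
rewrite -laplacian_form; apply: rayleigh_lower_bound.
- by rewrite /symmetrized_laplacian linearB linearZ linearD /= trmx1 trmxK [M^T + M]addrC.
- apply/row_subP => i; apply: (fixed_multiple phi_gt0 M0 phiM phiMT conM).
  apply/esym/eqP; rewrite -subr_eq0 -laplacian_form -row_mul mulmx_ker.
  by rewrite row0 /dot mul0mx mxE.
- by case: lamP.
Qed.

Lemma spectral_gap_gt0 : 0 < lam.
Proof. by case: lamP => /eigenvalue_laplacian_ge0 + ? _; rewrite lt_def => ->; rewrite andbT. Qed.

(* Test the gap on the vector supported on {x, y} that is orthogonal to phi. *)
Lemma spectral_gap_le1 x y : x != y -> M x x = 0 -> M x y = 0 ->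
  M y x = 0 -> M y y = 0 -> lam <= 1.
Proof.
move=> ne_xy Mxx Mxy Myx Myy.
pose e z : 'rV[R]_n := delta_mx 0 z.
pose f := phi 0 y *: e x - phi 0 x *: e y.
have eM z t : dot (e z *m M) (e t) = M z t by rewrite dot_delta -rowE mxE.
have fphi : dot f phi = 0.
  by rewrite /f !dot_linear !(dotC _ phi) !dot_delta mulrC subrr.
have fM : dot (f *m M) f = 0.
  rewrite /f mulmxBl -!scalemxAl !dot_linear !eM Mxx Mxy Myx Myy.
  by ring.
have f0 : f != 0.
  apply/eqP => /rowP/(_ x); rewrite !mxE !eqxx (negPf ne_xy) mulr1 mulr0 subr0.
  by move/eqP; rewrite gt_eqF.
by have := spectral_gap fphi; rewrite fM subr0 ger_pMl // dot_gt0.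
Qed.

Lemma short_path t x y : lam < 2 ->
    (1 - lam / 2) ^+ t <= (phi 0 x * phi 0 y / dot phi phi) ^+ 2 ->
  exists p, [/\ path (fun i j => M i j != 0) x p, last x p = y & (size p <= t)%N].
Proof.
move=> lam_lt2 small; apply: lazy_iter_path.
exact: (lazy_iter_neq0 phi_gt0 M0 phiM phiMT lam_lt2 spectral_gap small).
Qed.

End SymmetrizedLaplacian.

(** * The number of steps, from logarithms *)

Lemma decay_of_log_ratio (R : realType) (lam a : R) (t : nat) :
    0 < lam -> lam < 2 -> 0 < a ->
    2 * ln a / ln (2 / (2 - lam)) <= t%:R ->
  (1 - lam / 2) ^+ t <= a^-1 ^+ 2.
Proof.
move=> lam0 lam2 a0.
have q0 : 0 < 1 - lam / 2 by lra.
have q1 : 1 - lam / 2 < 1 by lra.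
have -> : 2 / (2 - lam) = (1 - lam / 2)^-1 by field; rewrite gt_eqF // subr_gt0.
have lnq : ln (1 - lam / 2) < 0 by rewrite ln_lt0 // q0.
(* The denominator is -ln (1 - lam / 2), which is positive, so clearing it keeps the direction of
   the inequality. *)
rewrite lnV ?posrE // ler_pdivrMr ?oppr_gt0 // => le_t.
rewrite -ler_ln ?posrE ?exprn_gt0 ?invr_gt0 // !lnXn ?invr_gt0 // lnV ?posrE //.
by rewrite -[leLHS]mulr_natl -[leRHS]mulr_natl mulrN lerNr -mulrN.
Qed.

(** * The digraph of s-tuples *)

Lemma card_setE (T : finType) (A : {set T}) (P : pred T) :
  #|[set e in A | P e]| = (\sum_(e in A) P e)%N.
Proof.
rewrite -sum1_card (eq_bigl (fun e => (e \in A) && P e)) => [|e]; last by rewrite inE.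
by rewrite big_mkcondr; apply: eq_bigr => e _; case: (P e).
Qed.

Section Tuples.
Local Open Scope nat_scope.
Variable V : finType.

Lemma size_coords s (x : dtuple V s) : size (coords x) = s.
Proof. exact: size_tuple. Qed.

Lemma uniq_coords s (x : dtuple V s) : uniq (coords x).
Proof. exact: (svalP x). Qed.

Lemma coords_inj s : injective (@coords V s).
Proof. by move=> x y exy; do 2!apply: val_inj. Qed.

Lemma coords_exists s (l : seq V) :
  size l = s -> uniq l -> exists x : dtuple V s, coords x = l.
Proof.
move=> szl ul; have szlb : size l == s by apply/eqP.
by exists (exist (fun t : s.-tuple V => uniq t) (Tuple szlb) ul).
Qed.

Lemma in_support s (x : dtuple V s) (v : V) :
  (v \in support x) = (v \in coords x).
Proof. by rewrite inE. Qed.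

Lemma card_set_seq (l : seq V) : (#|[set:: l]| == size l) = uniq l.
Proof. by rewrite cardsE; apply/eqP/idP => /card_uniqP. Qed.

Lemma card_support s (x : dtuple V s) : #|support x| = s.
Proof.
by apply/eqP; rewrite -[in X in _ == X](size_coords x) card_set_seq uniq_coords.
Qed.

Lemma support_subset s (x : dtuple V s) (A : {set V}) :
  (support x \subset A) = all (mem A) (coords x).
Proof.
apply/subsetP/allP => sub v; last by rewrite in_support; apply: sub.
by rewrite -in_support; apply: sub.
Qed.

Lemma card_dtuple_subset s (A : {set V}) :
  #|[set x : dtuple V s | support x \subset A]| = #|A| ^_ s.
Proof.
rewrite -card_uniq_tuples -(card_imset _ val_inj); apply: eq_card => t.
rewrite [in RHS]inE; apply/imsetP/andP => [[x + ->]|[tA ut]].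
  by rewrite inE support_subset => xA; split=> //; apply: uniq_coords.
exists (exist (fun t : s.-tuple V => uniq t) t ut) => //.
by rewrite inE support_subset.
Qed.

(** Reversal turns every arc around, which reduces in-degrees to out-degrees, and it supplies a
    second tuple with the same support. *)
Definition rev_dtuple s (x : dtuple V s) : dtuple V s :=
  exist (fun t : s.-tuple V => uniq t) [tuple of rev (sval x)]
    (etrans (rev_uniq _) (svalP x)).

Lemma coords_rev s (x : dtuple V s) : coords (rev_dtuple x) = rev (coords x).
Proof. by []. Qed.

Lemma rev_dtupleK s : involutive (@rev_dtuple s).
Proof. by move=> x; apply: coords_inj; rewrite !coords_rev revK. Qed.

Lemma support_rev s (x : dtuple V s) : support (rev_dtuple x) = support x.
Proof. by apply/setP => v; rewrite !in_support coords_rev mem_rev. Qed.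

Lemma rev_dtuple_neq s (x : dtuple V s) : 1 < s -> rev_dtuple x != x.
Proof.
move=> s1; apply/eqP => /(congr1 (@coords _ _)); rewrite coords_rev.
have := uniq_coords x; have := size_coords x; case: (coords x) => [|a l] szx ux eq_rev.
  by rewrite -szx in s1.
move/(congr1 (nth a ^~ 0)): eq_rev; rewrite nth_rev ?szx ?(ltnW s1) // => /eqP.
by rewrite nth_uniq ?szx ?(ltnW s1) //; lia.
Qed.

End Tuples.

Section Digraph.
Local Open Scope nat_scope.
Variables (V : finType) (r s : nat) (H : hypergraph V r).
Hypothesis hrs : r < 2 * s.
Hypothesis hsr : s < r.
Implicit Types x y z : dtuple V s.

Lemma degree_rev x : degree H (rev_dtuple x) = degree H x.
Proof. by rewrite /degree support_rev. Qed.

Lemma darc_rev x y : darc H (rev_dtuple y) (rev_dtuple x) = darc H x y.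
Proof.
rewrite /darc !support_rev setUC !coords_rev drop_rev take_rev !size_coords.
rewrite (inj_eq (can_inj revK)) eq_sym.
by congr ((drop _ _ == take _ _) && _); lia.
Qed.

(** Double counting of the pairs of a tuple and an edge containing it: each edge contains r (r - 1)
    ... (s + 1) tuples... that is [r ^_ s] of them, of which each counts (r - s)! times. *)
Lemma volumeE : volume H s = #|edges H| * r`!.
Proof.
rewrite /volume /degree -big_distrl /= /set_degree.
have -> : \sum_(x : dtuple V s) #|[set e in edges H | support x \subset e]| =
    \sum_(e in edges H) #|[set x : dtuple V s | support x \subset e]|.
  transitivity (\sum_(x : dtuple V s) \sum_(e in edges H) (support x \subset e : nat)).
    by apply: eq_bigr => x _; apply: card_setE.
  rewrite exchange_big; apply: eq_bigr => e _.
  by rewrite -sum1dep_card [RHS]big_mkcond; apply: eq_bigr => x _; case: ifP.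
rewrite (eq_bigr (fun _ => r ^_ s)) => [|e eH]; last first.
  by rewrite card_dtuple_subset (edges_uniform eH).
by rewrite sum_nat_const -mulnA ffact_fact // ltnW.
Qed.

(** The first 2s - r coordinates of [y] already occur in [x]; only the last r - s can be new. *)
Lemma support_edge x y : drop (r - s) (coords x) = take (2 * s - r) (coords y) ->
  support x :|: support y = support x :|: [set:: drop (2 * s - r) (coords y)].
Proof.
move=> exy; apply/setP => v; rewrite !inE.
rewrite -[in v \in coords y](cat_take_drop (2 * s - r) (coords y)).
rewrite mem_cat -exy orbA.
by case: (boolP (v \in drop _ (coords x))) => [/mem_drop ->|]; rewrite ?orbT ?orbF.
Qed.

Lemma card_tail_union x (l : seq V) : uniq l -> size l = r - s ->
  (#|support x :|: [set:: l]| == r) = [disjoint support x & [set:: l]].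
Proof.
move=> ul szl; rewrite -(leq_card_setU (support x) [set:: l]) card_support.
by move/eqP: ul; rewrite -card_set_seq => /eqP/eqP->; rewrite szl subnKC // ltnW.
Qed.

(** Out-neighbours are grouped by the edge they span with [x]. Within an edge the first 2s - r
    coordinates are dictated by [x], and the other r - s are an ordering of the rest of the edge,
    which gives (r - s)! choices. *)
Lemma card_darc x : #|[set y | darc H x y]| = degree H x.
Proof.
rewrite -sum1dep_card (partition_big (fun y => support x :|: support y)
    (fun e => (e \in edges H) && (support x \subset e))) /=; last first.
  by move=> y /andP[_ ->]; rewrite subsetUl.
rewrite /degree /set_degree -sum1dep_card big_distrl /=.
apply: eq_bigr => e /andP[eH xe]; rewrite mul1n sum1dep_card.
have szd y : size (drop (2 * s - r) (coords y)) == r - s.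
  by rewrite size_drop size_coords; apply/eqP; lia.
pose tail y : (r - s).-tuple V := Tuple (szd y).
rewrite -(card_in_imset (f := tail)); last first.
  move=> y y'; rewrite !inE => /andP[/andP[/eqP xy _] _] /andP[/andP[/eqP xy' _] _].
  move/(congr1 val) => /= etail; apply: coords_inj.
  by rewrite -(cat_take_drop (2 * s - r) (coords y)) etail -xy xy' cat_take_drop.
have -> : (r - s)`! = #|e :\: support x| ^_ (r - s).
  by rewrite cardsD (setIidPr xe) card_support (edges_uniform eH) ffactnn.
rewrite -card_uniq_tuples; apply: eq_card => z; rewrite [in RHS]inE.
apply/imsetP/andP => [[y + ->]|[ze uz]].
  rewrite inE => /andP[/andP[/eqP xy _] /eqP xye] /=.
  split; last exact: drop_uniq (uniq_coords y).
  rewrite (support_edge xy) in xye.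
  have := card_tail_union x (drop_uniq (2 * s - r) (uniq_coords y)) (eqP (szd y)).
  rewrite xye (edges_uniform eH) eqxx => /esym xt.
  apply/allP => v vt; have vt' : v \in [set:: drop (2 * s - r) (coords y)] by rewrite inE.
  by rewrite -[X in is_true X]/(v \in e :\: support x) in_setD (disjointFl xt vt') -xye
    in_setU vt' orbT.
have {}ze v : v \in z -> v \in e :\: support x by move/(allP ze).
(* Conversely, an ordering [z] of the rest of the edge, appended to the overlap with [x], is an
   out-neighbour. *)
have [y coordsy] : exists y : dtuple V s, coords y = drop (r - s) (coords x) ++ z.
  apply: coords_exists; first by rewrite size_cat size_drop size_coords size_tuple; lia.
  rewrite cat_uniq uz drop_uniq ?uniq_coords // andbT; apply/hasPn => v /ze.
  by rewrite !inE => /andP[vx _]; apply: contra vx => /mem_drop; rewrite -in_support.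
have szx : size (drop (r - s) (coords x)) = 2 * s - r.
  by rewrite size_drop size_coords; lia.
have xy : drop (r - s) (coords x) = take (2 * s - r) (coords y).
  by rewrite coordsy take_size_cat.
have xye : support x :|: support y = e.
  rewrite (support_edge xy) coordsy drop_size_cat //; apply/eqP.
  rewrite eqEcard subUset xe (edges_uniform eH) /=; apply/andP; split.
    by apply/subsetP => v; rewrite inE => /ze; rewrite inE => /andP[].
  rewrite leq_eqVlt eq_sym card_tail_union ?size_tuple // disjoint_sym disjoint_subset.
  by apply/orP; left; apply/subsetP => v; rewrite inE => /ze; rewrite !inE => /andP[].
exists y.
  by rewrite inE /darc xy xye eH !eqxx.
by apply: val_inj; rewrite /= coordsy drop_size_cat.
Qed.
End Digraph.

(** * Walks of the hypergraph as directed paths *)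

Lemma mem_drop_leq (T : eqType) (l : seq T) m n v :
  (m <= n)%N -> v \in drop n l -> v \in drop m l.
Proof. by move=> lemn; rewrite -(subnK lemn) -drop_drop => /mem_drop. Qed.

Section Walks.
Local Open Scope nat_scope.
Variables (V : finType) (r s : nat) (H : hypergraph V r).
Hypothesis hrs : r < 2 * s.
Hypothesis hsr : s < r.
Implicit Types x y z : dtuple V s.

Local Notation arc := (@darc V r H s).

(** Reversal maps the in-neighbours of [y] to the out-neighbours of its reversal, so the digraph is
    Eulerian. *)
Lemma card_darc_in y : #|[set x | darc H x y]| = degree H y.
Proof.
rewrite -degree_rev -(card_darc H hrs hsr) -(card_imset _ (inv_inj (@rev_dtupleK V s))).
apply: eq_card => x; rewrite [RHS]inE; apply/imsetP/idP => [[z + ->]|yx].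
  by rewrite inE darc_rev.
by exists (rev_dtuple x); rewrite ?rev_dtupleK // inE -darc_rev // rev_dtupleK.
Qed.

Lemma degree_gt0 x y : darc H x y -> 0 < degree H x.
Proof.
move=> xy; rewrite -(card_darc H hrs hsr) card_gt0.
by apply/set0Pn; exists y; rewrite inE.
Qed.

(** Equal supports would have a union of only s < r elements. *)
Lemma darc_support_neq x y : darc H x y -> support x != support y.
Proof.
case/andP=> _ eH; apply: contraTneq eH => ->; rewrite setUid.
by apply/negP => /edges_uniform; rewrite card_support; lia.
Qed.

(** The first s and the last s entries of an edge window overlap in its middle 2s - r entries and
    together cover it, because r < 2s. *)
Lemma darc_window (w : seq V) : size w = r -> [set:: w] \in edges H ->
  exists x y, [/\ coords x = take s w, coords y = drop (r - s) w & darc H x y].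
Proof.
move=> szw wH.
have uw : uniq w by rewrite -card_set_seq (edges_uniform wH) szw.
have [x cx] : exists x : dtuple V s, coords x = take s w.
  by apply: coords_exists; rewrite ?take_uniq // size_take szw hsr.
have [y cy] : exists y : dtuple V s, coords y = drop (r - s) w.
  by apply: coords_exists; rewrite ?drop_uniq // size_drop szw; lia.
exists x, y; split=> //; rewrite /darc cx cy take_drop; apply/andP; split.
  by apply/eqP; congr (drop _ (take _ _)); lia.
rewrite (_ : _ :|: _ = [set:: w]) //; apply/setP => v; rewrite !inE cx cy.
apply/orP/idP => [[/mem_take|/mem_drop] //|].
rewrite -{1}(cat_take_drop s w) mem_cat => /orP[->|vd]; [by left | right].
by apply: mem_drop_leq vd; lia.
Qed.

Lemma walk_edge_stops (v : seq V) i : (r - s) * i + r <= size v ->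
    walk_edge r s v i \in edges H ->
  exists x y, [/\ coords x = stop r s v i, coords y = stop r s v i.+1 & darc H x y].
Proof.
move=> szv /darc_window[|x [y [cx cy xy]]].
  by rewrite size_take_min size_drop; lia.
exists x, y; split=> //; first by rewrite cx take_takel // ltnW.
by rewrite cy /stop mulnS -drop_drop [RHS]take_drop subnKC // ltnW.
Qed.

Lemma darc_of_path x y k : has_path H x y k ->
  exists2 p, path arc x p & last x p = y.
Proof.
case/existsP=> v /and3P[/andP[/forallP walkv _] /eqP v0 /eqP vk].
suff prefix i : i <= k -> exists2 p, path arc x p & coords (last x p) = stop r s v i.
  by have [p pth lastp] := prefix k (leqnn k); exists p => //; apply: coords_inj; rewrite lastp.
elim: i => [|i IHi] ltik; first by exists [::].
have [p pth lastp] := IHi (ltnW ltik).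
have szv : (r - s) * i + r <= size v.
  by rewrite size_tuple; have := leq_mul (leqnn (r - s)) ltik; rewrite mulnS; lia.
have [z [t [cz ct zt]]] := walk_edge_stops szv (walkv (Ordinal ltik)).
exists (rcons p t); last by rewrite last_rcons.
(* Coordinates determine a tuple, so the tail of the new arc is the current end of the path. *)
by rewrite rcons_path pth /= (coords_inj (etrans lastp (esym cz))).
Qed.

(** The vertex sequence traced by a directed path: each arc appends the r - s coordinates beyond the
    overlap. *)
Definition vertices x (p : seq (dtuple V s)) : seq V :=
  coords x ++ flatten [seq drop (2 * s - r) (coords y) | y <- p].

Lemma drop_vertices x y p : darc H x y ->
  drop (r - s) (vertices x (y :: p)) = vertices y p.
Proof.
case/andP=> /eqP xy _; rewrite /vertices /= drop_cat size_coords.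
have -> : r - s < s by lia.
by rewrite xy catA cat_take_drop.
Qed.

Lemma drop_vertices_nth x p i : path arc x p -> i <= size p ->
  drop ((r - s) * i) (vertices x p) = vertices (nth x (x :: p) i) (drop i p).
Proof.
elim: i x p => [|i IHi] x [|y p] //=; rewrite ?muln0 ?drop0 // ltnS => /andP[xy pth] lip.
rewrite mulnS addnC -drop_drop drop_vertices // IHi //.
by rewrite (set_nth_default x).
Qed.

Lemma size_vertices x p : size (vertices x p) = (r - s) * size p + s.
Proof.
rewrite size_cat size_coords addnC; congr (_ + _).
elim: p => [|y p IHp]; first by rewrite muln0.
by rewrite /= size_cat IHp size_drop size_coords mulnS; congr (_ + _); lia.
Qed.

Lemma stop_vertices x p i : path arc x p -> i <= size p ->
  stop r s (vertices x p) i = coords (nth x (x :: p) i).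
Proof. by move=> pth lip; rewrite /stop drop_vertices_nth // take_size_cat ?size_coords. Qed.

Lemma has_path_of_darc x p : path arc x p -> uniq (x :: p) ->
  has_path H x (last x p) (size p).
Proof.
move=> pth up; have szv : size (vertices x p) == (r - s) * size p + s by rewrite size_vertices.
apply/existsP; exists (Tuple szv); rewrite /= !stop_vertices //.
rewrite -last_nth !eqxx !andbT; apply/andP; split.
  apply/forallP => -[i ltip] /=; rewrite /walk_edge drop_vertices_nth //; last exact: ltnW.
  move/pathP: (pth) => /(_ x i ltip); set y := nth x (x :: p) i => yz.
  (* The window of r vertices consists of the s coordinates of [y] and the last r - s of the next
     tuple, which together form the edge of the arc. *)
  rewrite (drop_nth x ltip) /vertices /= catA take_size_cat; last first.
    by rewrite size_cat size_drop !size_coords; lia.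
  case/andP: yz => /eqP yz; rewrite (support_edge yz).
  rewrite (_ : _ :|: _ = [set:: coords y ++ drop (2 * s - r) (coords (nth x p i))]) //.
  by apply/setP => v; rewrite !inE mem_cat.
rewrite (_ : map _ _ = map (@coords V s) (x :: p)).
  by rewrite (map_inj_uniq (@coords_inj V s)).
apply: (@eq_from_nth _ [::]) => [|i]; first by rewrite !size_map size_iota.
rewrite size_map size_iota => lti; rewrite (nth_map 0) ?size_iota //.
by rewrite nth_iota // add0n stop_vertices // (nth_map x).
Qed.

(** An [s]-path needs distinct stops, so repetitions are first cut out of the directed path, which
    does not lengthen it. *)
Lemma s_distance_le (conn : s_connected H s) x p :
  path arc x p -> s_distance conn x (last x p) <= size p.
Proof.
move=> pth; rewrite /s_distance; case: ex_minnP => m + minm.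
case/shortenP: pth minm => p' pth' up' subp' minm _.
apply: leq_trans (minm _ (has_path_of_darc pth' up')) _.
by apply: uniq_leq_size => //; case/andP: up'.
Qed.

End Walks.

(** * The normalized adjacency matrix *)

Lemma bigminn_leq (T : finType) (v : nat) (F : T -> nat) x :
  (\big[minn/v]_y F y <= F x)%N.
Proof.
have: x \in index_enum T by exact: mem_index_enum.
elim: (index_enum T) => // y l IHl; rewrite inE big_cons => /orP[/eqP->|/IHl le_x].
  exact: geq_minl.
by rewrite geq_min le_x orbT.
Qed.

Section NormalizedAdjacency.
Variables (R : rcfType) (V : finType) (r s : nat) (H : hypergraph V r).
Hypothesis hrs : (r < 2 * s)%N.
Hypothesis hsr : (s < r)%N.
Hypothesis conn : s_connected H s.

Local Notation N := #|dtuple V s|.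

Definition normalized_adjacency : 'M[R]_N :=
  degree_invsqrt H s R *m adjacency H s R *m degree_invsqrt H s R.

Definition sqrt_degree : 'rV[R]_N :=
  \row_i Num.sqrt (degree H (enum_val i))%:R.

Local Notation M := normalized_adjacency.
Local Notation phi := sqrt_degree.

Lemma rev_dtuple_neq_r (x : dtuple V s) : rev_dtuple x != x.
Proof. by apply: rev_dtuple_neq; lia. Qed.

(** A path from [x] to its reversal, a different tuple, must leave [x] by an arc. *)
Lemma degree_positive (x : dtuple V s) : (0 < degree H x)%N.
Proof.
have [k /(darc_of_path hrs hsr)[[|y p] /= pth lastp]] := conn x (rev_dtuple x).
  by have := rev_dtuple_neq_r x; rewrite -lastp eqxx.
by case/andP: pth => /(degree_gt0 hrs hsr).
Qed.

Lemma normalized_adjacencyE i j : M i j =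
  (phi 0 i)^-1 * (darc H (enum_val i) (enum_val j))%:R * (phi 0 j)^-1.
Proof. by rewrite /M /degree_invsqrt mul_mx_diag mul_diag_mx !mxE. Qed.

Lemma laplacianE : laplacian H s R = symmetrized_laplacian M.
Proof.
rewrite /laplacian /dlaplacian -/M linearB /= trmx1 /symmetrized_laplacian.
rewrite addrACA -opprD scalerBr -mulr2n -scaler_nat scalerA mulVf ?scale1r //.
by rewrite pnatr_eq0.
Qed.

Lemma sqrt_degree_gt0 i : 0 < phi 0 i.
Proof. by rewrite mxE sqrtr_gt0 ltr0n degree_positive. Qed.

Let phi_neq0 i : phi 0 i != 0. Proof. by rewrite gt_eqF ?sqrt_degree_gt0. Qed.

Lemma sqr_sqrt_degree i : phi 0 i ^+ 2 = (degree H (enum_val i))%:R.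
Proof. by rewrite mxE sqr_sqrtr ?ler0n. Qed.

Lemma normalized_adjacency_ge0 i j : 0 <= M i j.
Proof.
by rewrite normalized_adjacencyE !mulr_ge0 ?invr_ge0 ?ler0n // ltW ?sqrt_degree_gt0.
Qed.

Lemma normalized_adjacency_neq0 i j :
  (M i j != 0) = darc H (enum_val i) (enum_val j).
Proof.
rewrite normalized_adjacencyE !mulf_eq0 !invr_eq0 !(negPf (phi_neq0 _)) orbF.
by rewrite pnatr_eq0 eqb0 negbK.
Qed.

(** The factor phi_i cancels, and entry j becomes the in-degree divided by phi_j. The in-degree is
    phi_j^2. *)
Lemma sqrt_degree_fixed : phi *m M = phi.
Proof.
apply/rowP => j; rewrite mxE.
rewrite (eq_bigr (fun i => (darc H (enum_val i) (enum_val j))%:R / phi 0 j)) => [|i _]; last first.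
  by rewrite normalized_adjacencyE !mulrA divff ?mul1r.
rewrite -mulr_suml -(big_enum_val (fun x => (darc H x (enum_val j))%:R)) /=.
have -> : \sum_(x : dtuple V s) (darc H x (enum_val j))%:R = phi 0 j ^+ 2.
  rewrite sqr_sqrt_degree -(card_darc_in H hrs hsr) -sum1dep_card natr_sum.
  by rewrite [RHS]big_mkcond; apply: eq_bigr => x _; case: darc.
by rewrite expr2 mulfK.
Qed.

Lemma sqrt_degree_fixed_tr : phi *m M^T = phi.
Proof.
apply/rowP => j; rewrite mxE.
rewrite (eq_bigr (fun i => (darc H (enum_val j) (enum_val i))%:R / phi 0 j)) => [|i _]; last first.
  by rewrite [M^T _ _]mxE normalized_adjacencyE mulrC mulfVK // mulrC.
rewrite -mulr_suml -(big_enum_val (fun x => (darc H (enum_val j) x)%:R)) /=.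
have -> : \sum_(x : dtuple V s) (darc H (enum_val j) x)%:R = phi 0 j ^+ 2.
  rewrite sqr_sqrt_degree -(card_darc H hrs hsr) -sum1dep_card natr_sum.
  by rewrite [RHS]big_mkcond; apply: eq_bigr => x _; case: darc.
by rewrite expr2 mulfK.
Qed.

Lemma normalized_adjacency_connect i j :
  connect (fun i j => M i j != 0) i j.
Proof.
have [k /(darc_of_path hrs hsr)[p pth lastp]] := conn (enum_val i) (enum_val j).
apply/connectP; exists (map enum_rank p); last first.
  by rewrite -[i in last i _]enum_valK last_map lastp enum_valK.
rewrite -[i in path _ i _]enum_valK path_map.
by apply: sub_path pth => x y xy; rewrite /= normalized_adjacency_neq0 !enum_rankK.
Qed.

Lemma normalized_adjacency_eq0 i j :
  support (enum_val i) = support (enum_val j) -> M i j = 0.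
Proof.
move=> eij; apply/eqP; rewrite -[_ == _]negbK normalized_adjacency_neq0.
by apply/negP => /(darc_support_neq hrs hsr); rewrite eij eqxx.
Qed.

Lemma laplacian_gap_gt0 lam :
  smallest_nonzero_eigenvalue (laplacian H s R) lam -> 0 < lam.
Proof.
rewrite laplacianE => /(spectral_gap_gt0 sqrt_degree_gt0 normalized_adjacency_ge0).
by apply; [exact: sqrt_degree_fixed | exact: sqrt_degree_fixed_tr].
Qed.

(* A tuple and its reversal have the same support, so there is no arc between them. *)
Lemma laplacian_gap_le1 lam (x : dtuple V s) :
  smallest_nonzero_eigenvalue (laplacian H s R) lam -> lam <= 1.
Proof.
rewrite laplacianE => lamP.
apply: (spectral_gap_le1 sqrt_degree_gt0 normalized_adjacency_ge0 sqrt_degree_fixed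
  sqrt_degree_fixed_tr normalized_adjacency_connect lamP
  (x := enum_rank x) (y := enum_rank (rev_dtuple x))).
- by rewrite (inj_eq enum_rank_inj) eq_sym rev_dtuple_neq_r.
all: by apply: normalized_adjacency_eq0; rewrite !enum_rankK ?support_rev.
Qed.

Lemma dot_sqrt_degree : dot phi phi = (volume H s)%:R.
Proof.
rewrite dotE /volume natr_sum (big_enum_val (fun x => (degree H x)%:R)) /=.
by apply: eq_bigr => i _; rewrite -expr2 sqr_sqrt_degree.
Qed.

Lemma min_degree_le (x : dtuple V s) : (min_degree H s <= degree H x)%N.
Proof. exact: bigminn_leq. Qed.

Lemma degree_le_volume (x : dtuple V s) : (degree H x <= volume H s)%N.
Proof. by rewrite /volume (bigD1 x) //= leq_addr. Qed.

Lemma min_degree_gt0 (x : dtuple V s) : (0 < min_degree H s)%N.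
Proof.
rewrite /min_degree; elim/big_ind: _ => [|a b a0 b0|y _].
(* The initial value of the minimum is the volume, positive because it dominates the degree of
   [x]. *)
- exact: leq_trans (degree_positive x) (degree_le_volume x).
- by rewrite leq_min a0 b0.
- exact: degree_positive.
Qed.

(** Since d_x d_y is at least the square of the minimum degree, the assumed decay suffices for
    [short_path] at every pair of tuples. *)
Lemma s_distance_bound lam t (x y : dtuple V s) :
    smallest_nonzero_eigenvalue (laplacian H s R) lam ->
    (1 - lam / 2) ^+ t <= ((volume H s)%:R / (min_degree H s)%:R)^-1 ^+ 2 ->
  (s_distance conn x y <= t)%N.
Proof.
move=> lamP small; have lam_lt2 : lam < 2.
  by apply: le_lt_trans (laplacian_gap_le1 x lamP) _; rewrite ltr1n.
have vol0 : 0 < (volume H s)%:R :> R.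
  by rewrite ltr0n (leq_trans (degree_positive x)) ?degree_le_volume.
have := @short_path R _ phi M lam sqrt_degree_gt0 normalized_adjacency_ge0
  sqrt_degree_fixed sqrt_degree_fixed_tr normalized_adjacency_connect.
rewrite -laplacianE => /(_ lamP t (enum_rank x) (enum_rank y) lam_lt2)[].
  apply: le_trans small _; rewrite dot_sqrt_degree invf_div !expr_div_n.
  rewrite ler_wpM2r ?invr_ge0 ?exprn_ge0 ?ler0n // exprMn !sqr_sqrt_degree !enum_rankK.
  by rewrite expr2 ler_pM ?ler0n // ler_nat min_degree_le.
move=> p [pth lastp szp]; apply: leq_trans szp.
have <- : last x (map enum_val p) = y.
  by rewrite -[x in last x _](enum_rankK x) last_map lastp enum_rankK.
rewrite -(size_map enum_val p); apply: (s_distance_le hrs hsr).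
rewrite -[x in path _ x _](enum_rankK x) path_map.
by apply: sub_path pth => i j; rewrite normalized_adjacency_neq0.
Qed.

End NormalizedAdjacency.

Theorem theorem14 (R : realType) (V : finType) (r s : nat)
  (hr : (3 <= r)%N) (hrs : (r < 2 * s)%N) (hsr : (s <= r - 1)%N)
  (hV : (r <= #|V|)%N)
  (H : hypergraph V r) (conn : s_connected H s)
  (lambda1 : R)
  (hlambda1 : smallest_nonzero_eigenvalue (laplacian H s R) lambda1) :
  volume H s = (#|edges H| * r`!)%N /\
  (s_diameter conn)%:Z <=
    Num.ceil (2 * ln ((volume H s)%:R / (min_degree H s)%:R)
              / ln (2 / (2 - lambda1))).
Proof.
have hsr' : (s < r)%N by lia.
split; first exact: volumeE.
(* A nonzero eigenvector has a nonzero coordinate, whose index provides a tuple. *)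
have [/eigenvalueP[f _ /rV0Pn[i _]] _ _] := hlambda1.
have lam0 := laplacian_gap_gt0 hrs hsr' conn hlambda1.
have lam1 := laplacian_gap_le1 hrs hsr' conn (enum_val i) hlambda1.
have lam2 : lambda1 < 2 by apply: le_lt_trans lam1 _; rewrite ltr1n.
set a : R := _ / (min_degree H s)%:R; set K := 2 * ln a / _.
have delta0 : 0 < (min_degree H s)%:R :> R.
  by rewrite ltr0n (min_degree_gt0 hrs hsr' conn (enum_val i)).
have a1 : 1 <= a.
  rewrite ler_pdivlMr // mul1r ler_nat.
  exact: leq_trans (min_degree_le H (enum_val i)) (degree_le_volume H (enum_val i)).
have K0 : 0 <= K.
  apply: divr_ge0; first by rewrite mulr_ge0 ?ln_ge0.
  by rewrite ln_ge0 // ler_pdivlMr ?subr_gt0 // mul1r lerBlDr lerDl ltW.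
(* A nonnegative ceiling is a natural number and can serve as the number [t] of steps. *)
have ceilK0 : 0 <= Num.ceil K by rewrite ceil_ge0 (lt_le_trans _ K0) ?ltrN10.
rewrite -(gez0_abs ceilK0) lez_nat.
apply/bigmax_leqP => x _; apply/bigmax_leqP => y _.
apply: (s_distance_bound hrs hsr' _ _ _ hlambda1).
apply: decay_of_log_ratio => //; first exact: lt_le_trans ltr01 a1.
by rewrite -[leRHS]/((`|Num.ceil K|%N%:Z)%:~R) gez0_abs ?ceil_ge.
Qed.
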